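(* A finite simple group is fully realizable if and only if it is isomorphic to either $\mathbf{C}_2$ or $\mathbf{C}_3$.
   Context: Rings are associative with identity and ring homomorphisms preserve the identity. $R^\times$ is the group of units of a ring $R$; a ring endomorphism $\psi$ of $R$ restricts to a group endomorphism $\psi^\times$ of $R^\times$. A group $G$ is fully realizable if there is a ring $R$ with $R^\times = G$ (up to isomorphism) such that every group endomorphism of $G$ is of the form $\psi^\times$ for some ring endomorphism $\psi$ of $R$. $\mathbf{C}_m$ denotes the cyclic group of order $m$. A simple group is a nontrivial group whose only normal subgroups are the trivial subgroup and the group itself (cyclic groups of prime order are included). *)

(* Defs.v *)
From HB Require Import structures.
From mathcomp Require Import all_boot all_order all_algebra all_fingroup all_solvable.

Set Implicit Arguments.
Unset Strict Implicit.
Unset Printing Implicit Defensive.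

Import GRing.Theory.
Local Open Scope ring_scope.

(* MathComp only provides the group of units of a finite ring that is equipped
   with a decidable unit predicate. For an arbitrary ring, a unit is encoded as
   the pair (u, v) of an element and its two-sided inverse; since v is
   determined by u, this is the set of units of R (see [uval_inj] and [uvalP]
   below). *)
Section UnitGroup.
Variable R : pzRingType.

Record units := Units {
  uval_pair : R * R;
  _ : (uval_pair.1 * uval_pair.2 == 1) && (uval_pair.2 * uval_pair.1 == 1)
}.

HB.instance Definition _ := [isSub for uval_pair].
HB.instance Definition _ := [Choice of units by <:].

Definition uval (u : units) : R := (uval_pair u).1.
Definition uinv_val (u : units) : R := (uval_pair u).2.

Lemma uval_mulV u : uval u * uinv_val u = 1.
Proof. by have /andP[/eqP] := valP u. Qed.

Lemma uval_Vmul u : uinv_val u * uval u = 1.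
Proof. by have /andP[_ /eqP] := valP u. Qed.

Lemma uval_inj : injective uval.
Proof.
move=> u v eq_uv; apply/val_inj.
have eq_inv : uinv_val u = uinv_val v.
  by rewrite -[LHS]mulr1 -(uval_mulV v) mulrA -eq_uv uval_Vmul mul1r.
rewrite [val u]surjective_pairing [val v]surjective_pairing.
by rewrite -/(uval u) -/(uval v) -/(uinv_val u) -/(uinv_val v) eq_uv eq_inv.
Qed.

Lemma uvalP (x : R) :
  (exists u : units, uval u = x) <-> (exists y, x * y = 1 /\ y * x = 1).
Proof.
split=> [[u <-]|[y [xy yx]]].
  by exists (uinv_val u); rewrite uval_mulV uval_Vmul.
have xyP : ((x, y).1 * (x, y).2 == 1) && ((x, y).2 * (x, y).1 == 1).
  by rewrite /= xy yx eqxx.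
by exists (Units xyP).
Qed.

Fact units1_subproof :
  (((1, 1) : R * R).1 * ((1, 1) : R * R).2 == 1)
  && (((1, 1) : R * R).2 * ((1, 1) : R * R).1 == 1).
Proof. by rewrite /= mulr1 eqxx. Qed.

Definition units1 : units := Units units1_subproof.

Fact unitsM_subproof (u v : units) :
  let p := (uval u * uval v, uinv_val v * uinv_val u) in
  (p.1 * p.2 == 1) && (p.2 * p.1 == 1).
Proof.
rewrite /= -mulrA [uval v * _]mulrA uval_mulV mul1r uval_mulV eqxx /=.
by rewrite -mulrA [uinv_val u * _]mulrA uval_Vmul mul1r uval_Vmul.
Qed.

Definition unitsM (u v : units) : units := Units (unitsM_subproof u v).

Fact unitsV_subproof (u : units) :
  let p := (uinv_val u, uval u) in (p.1 * p.2 == 1) && (p.2 * p.1 == 1).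
Proof. by rewrite /= uval_mulV uval_Vmul eqxx. Qed.

Definition unitsV (u : units) : units := Units (unitsV_subproof u).

Fact unitsA : associative unitsM.
Proof. by move=> u v w; apply/uval_inj/mulrA. Qed.

Fact units1M : left_id units1 unitsM.
Proof. by move=> u; apply/uval_inj/mul1r. Qed.

Fact unitsM1 : right_id units1 unitsM.
Proof. by move=> u; apply/uval_inj/mulr1. Qed.

Fact unitsVM : left_inverse units1 unitsV unitsM.
Proof. by move=> u; apply/uval_inj/uval_Vmul. Qed.

Fact unitsMV : right_inverse units1 unitsV unitsM.
Proof. by move=> u; apply/uval_inj/uval_mulV. Qed.

HB.instance Definition _ :=
  isGroup.Build units unitsA units1M unitsM1 unitsVM unitsMV.

End UnitGroup.

Section UnitsMap.
Variables (R S : pzRingType) (psi : {rmorphism R -> S}).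

Fact units_map_subproof (u : units R) :
  let p := (psi (uval u), psi (uinv_val u)) in
  (p.1 * p.2 == 1) && (p.2 * p.1 == 1).
Proof. by rewrite /= -!rmorphM uval_mulV uval_Vmul rmorph1 eqxx. Qed.

Definition units_map (u : units R) : units S := Units (units_map_subproof u).

Fact units_map_is_multiplicative : {morph units_map : u v / (u * v)%g}.
Proof. by move=> u v; apply/uval_inj/rmorphM. Qed.

HB.instance Definition _ :=
  isMultiplicative.Build (units R) (units S) units_map
    units_map_is_multiplicative.

End UnitsMap.

(* The isomorphism f identifies G with the group of units of R. A map between
   groups that preserves products preserves 1 and inverses, so
   [{multiplicative G -> G}] is the type of all group endomorphisms of G. *)
Definition fully_realizable (G : groupType) : Prop :=
  exists (R : pzRingType) (f : {multiplicative G -> units R}),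
    bijective f /\
    forall phi : {multiplicative G -> G},
      exists psi : {rmorphism R -> R},
        forall g : G, f (phi g) = units_map psi (f g).

(* Main.v *)
(* Let R realize G. The endomorphism realizing g |-> 1 fixes the unit -1, so R
   has characteristic 2.
   If G is abelian of order prime to 6 and g is in G, then 1 + g + g^2 is a
   unit h; applying inversion gives h^-1 g^2 = h, so h = g, g^2 = 1 and g = 1.
   If G is simple and not abelian, let S be the additive span of G in R: a
   finite ring with group of units G and an augmentation eps, in which
   x G x = 0 only for x = 0. A minimal left ideal in the kernel of eps is S e
   with e idempotent and e S e a finite domain, hence a field; a maximal system
   of matrix units over e S e sums to a central idempotent E, and simplicity
   makes G the group of units of E S E = M_n(e S e). Triviality of the center
   leaves e S e = F_2, and the Burnside p^a q^b theorem leaves n >= 3. Then the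
   transpose of the inverse is an automorphism of G that breaks the linear
   relation 1 + (1 + e12) + (1 + e23) + (1 + e12 + e23) = 0, so that no ring
   endomorphism realizes it.
   Conversely, groups of order 2 and 3 are fully realized by F_2[G]. *)
Require Import Defs.
From HB Require Import structures.
From mathcomp Require Import all_boot all_order all_algebra all_fingroup all_solvable.
From mathcomp Require Import finfield integral_char.

Set Implicit Arguments.
Unset Strict Implicit.
Unset Printing Implicit Defensive.

Import GRing.Theory.
Local Open Scope group_scope.
Local Open Scope ring_scope.

(** * Corner rings *)

Section Corner.
Variables (S : finPzRingType) (e : S).
Hypotheses (e_neq0 : e != 0) (ee : e * e = e).

Definition corner : pred S := fun x => e * x * e == x.

Fact corner_zmod_closed : zmod_closed corner.
Proof.
split=> [|x y /eqP xP /eqP yP]; first by rewrite unfold_in /corner mulr0 mul0r.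
by rewrite unfold_in /corner mulrBr mulrBl xP yP.
Qed.

HB.instance Definition _ := GRing.isZmodClosed.Build S corner corner_zmod_closed.

(** Its identity is [e], in general not that of [S], so only the additive structure is inherited. *)
Definition corner_ring := {x | corner x}.
HB.instance Definition _ := SubFinite.on corner_ring.
HB.instance Definition _ := [SubChoice_isSubZmodule of corner_ring by <:].

Fact corner_mul_subproof (x y : corner_ring) : corner (val x * val y).
Proof.
rewrite /corner -(eqP (valP x)) -(eqP (valP y)).
by rewrite !mulrA ee -!mulrA ee.
Qed.

Definition corner_mul (x y : corner_ring) : corner_ring := Sub _ (corner_mul_subproof x y).

Fact corner_one_subproof : corner e. Proof. by rewrite /corner !ee. Qed.
Definition corner_one : corner_ring := Sub _ corner_one_subproof.

Fact corner_mulA : associative corner_mul.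
Proof. by move=> x y z; apply/val_inj; rewrite /= mulrA. Qed.

Fact corner_mul1 : left_id corner_one corner_mul.
Proof.
move=> x; apply/val_inj.
by rewrite /= -[in RHS](eqP (valP x)) -[in LHS](eqP (valP x)) !mulrA ee.
Qed.

Fact corner_mulr1 : right_id corner_one corner_mul.
Proof.
move=> x; apply/val_inj.
by rewrite /= -[in RHS](eqP (valP x)) -[in LHS](eqP (valP x)) -!mulrA ee.
Qed.

Fact corner_mulDl : left_distributive corner_mul +%R.
Proof. by move=> x y z; apply/val_inj; rewrite /= mulrDl. Qed.

Fact corner_mulDr : right_distributive corner_mul +%R.
Proof. by move=> x y z; apply/val_inj; rewrite /= mulrDr. Qed.

Fact corner_1_neq0 : corner_one != 0.
Proof. by rewrite -val_eqE. Qed.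

HB.instance Definition _ := GRing.Zmodule_isNzRing.Build corner_ring
  corner_mulA corner_mul1 corner_mulr1 corner_mulDl corner_mulDr corner_1_neq0.
HB.instance Definition _ := FinRing.isNzRing.Build corner_ring.

(** Wedderburn's little theorem for the finite ring [e S e], phrased on elements of [S]. *)
Lemma corner_mulC :
  (forall x y, corner x -> corner y -> x * y = 0 -> x = 0 \/ y = 0) ->
  forall x y, corner x -> corner y -> x * y = y * x.
Proof.
move=> dom x y xP yP.
have domT : GRing.integral_domain_axiom corner_ring.
  move=> u v /(congr1 val) /= uv0; rewrite -!val_eqE /=.
  by apply/orP; case: (dom _ _ (valP u) (valP v) uv0) => ->; [left|right].
have := finDomain_mulrC domT (Sub x xP : corner_ring) (Sub y yP).
by move/(congr1 val).
Qed.

End Corner.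

(** * Nonabelian simple groups of units *)

Section SimpleGroup.
Variable gT : finGroupType.
Hypotheses (gT_simple : simple [set: gT]) (gT_nab : ~~ abelian [set: gT]).

Lemma simple_normal_neq1 (H : {group gT}) (h : gT) :
  H <| [set: gT] -> h \in H -> h != 1%g -> H :=: [set: gT].
Proof.
move=> nH hH h1; have [_ /(_ H nH)[H1|//]] := simpleP _ gT_simple.
by case/eqP: h1; apply/set1gP; rewrite -H1.
Qed.

Lemma nonabelian_simple_center z : (forall g : gT, commute z g) -> z = 1%g.
Proof.
move=> zC; apply/eqP/idPn => z1; case/negP: gT_nab.
have zZ : z \in 'Z([set: gT]).
  by rewrite inE in_setT; apply/centP => g _; apply: zC.
by rewrite -(simple_normal_neq1 (center_normal _) zZ z1) center_abelian.
Qed.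

(** The conjugates of [h] generate a normal subgroup; it is abelian, hence trivial. *)
Lemma nonabelian_simple_conj_commute h :
  (forall u v : gT, commute (h ^ u) (h ^ v)) -> h = 1%g.
Proof.
move=> hC; apply/eqP/idPn => h1; case/negP: gT_nab.
have nH : <<h ^: [set: gT]>> <| [set: gT].
  by rewrite /normal subsetT norms_gen // class_norm.
rewrite -(simple_normal_neq1 nH (mem_gen (class_refl _ h)) h1).
rewrite abelian_gen; apply/centsP => _ /imsetP[u _ ->] _ /imsetP[v _ ->].
exact: hC.
Qed.

(** Orders up to 16 have at most two prime divisors, so Burnside's theorem would make the group
    solvable. The bound is the number of 2 by 2 matrices over F_2. *)
Lemma nonabelian_simple_card_gt16 : (16 < #|gT|)%N.
Proof.
rewrite ltnNge; apply/negP => le16.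
have solG : solvable [set: gT].
  apply: Burnside_p_a_q_b; rewrite cardsT.
  move: #|gT| le16 => n; do 17 (case: n => [|n] //).
by case/negP: gT_nab; apply/cyclic_abelian/prime_cyclic/simple_sol_prime.
Qed.
End SimpleGroup.

(** * Finite rings of characteristic 2 additively spanned by their units *)

Section UnitSpan.
Variables (gT : finGroupType) (S : finPzRingType) (R : pzRingType).
Variables (f : gT -> S) (eps : {rmorphism S -> R}).
Hypotheses (gT_simple : simple [set: gT]) (gT_nab : ~~ abelian [set: gT]).
Hypotheses (f1 : f 1%g = 1) (fM : {morph f : g h / (g * h)%g >-> g * h}).
Hypotheses (f_inj : injective f).
Hypothesis f_unit : forall x y : S, x * y = 1 -> y * x = 1 -> exists g, f g = x.
Hypothesis f_span : forall s, exists X : {set gT}, s = \sum_(g in X) f g.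
Hypotheses (two0 : 1 + 1 = 0 :> S) (R_neq0 : 1 != 0 :> R).
Hypothesis eps_f : forall g, eps (f g) = 1.

Lemma span_addxx (x : S) : x + x = 0.
Proof. by rewrite -[x]mul1r -mulrDl two0 mul0r. Qed.

(* Otherwise the conjugates of the unit [1 + x] commute pairwise. *)
Lemma span_semiprime (x : S) : x != 0 -> exists g, x * f g * x != 0.
Proof.
move=> x0; case: (boolP [exists g, x * f g * x != 0]) => [/existsP //|/existsPn xgx].
have {}xgx g : x * f g * x = 0 by apply/eqP/negPn/xgx.
have xx : x * x = 0 by have := xgx 1%g; rewrite f1 mulr1.
have hu : (1 + x) * (1 + x) = 1.
  by rewrite mulrDl mul1r mulrDr mulr1 xx addr0 -addrA span_addxx addr0.
have [h fh] := f_unit hu hu.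
have fJ u : f (h ^ u) = 1 + f u^-1%g * x * f u.
  by rewrite conjgE !fM fh mulrDl mul1r mulrDr -fM mulVg f1 mulrA.
have fJJ u v : f (h ^ u * h ^ v)%g = 1 + (f u^-1%g * x * f u + f v^-1%g * x * f v).
  rewrite fM !fJ mulrDl mul1r mulrDr mulr1.
  (* The cross term contains [x * f (u * v^-1) * x], which vanishes. *)
  rewrite -[X in _ + (_ + X)](_ : 0 = _) ?addr0 ?addrA -1?[1 + _ + _]addrAC //.
  rewrite !mulrA -[_ * f u * f v^-1%g]mulrA -fM -!mulrA.
  by rewrite [x * (f _ * _)]mulrA [x * _ * _]mulrA xgx mul0r mulr0.
have hC u v : commute (h ^ u) (h ^ v).
  by apply: f_inj; rewrite !fJJ [_ * _ * _ + _]addrC.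
case/eqP: x0; apply: (addrI 1); rewrite addr0 -fh -f1.
by rewrite (nonabelian_simple_conj_commute gT_simple gT_nab hC).
Qed.

Lemma span_aug0 : exists2 x, x != 0 & eps x = 0.
Proof.
have [ntG _] := simpleP _ gT_simple; have [g _ g1] := trivgPn _ ntG.
exists (f g - 1); last by rewrite rmorphB rmorph1 eps_f subrr.
by rewrite subr_eq0 -f1 (inj_eq f_inj).
Qed.

(* Brauer: a left ideal [S x] of minimal size inside the kernel of [eps] is
   generated by an idempotent. *)
Lemma span_idempotent : exists e,
  [/\ e != 0, e * e = e, eps e = 0 &
      forall x, e * x * e != 0 -> exists y, y * (e * x * e) = e].
Proof.
pose L x : {set S} := [set s * x | s in S].
have LP s x : s * x \in L x by apply: imset_f.
have [x0 x0_neq0 eps_x0] := span_aug0.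
have : (x0 != 0) && (eps x0 == 0) by rewrite x0_neq0 eps_x0 eqxx.
case/(@arg_minnP _ x0 (fun x => (x != 0) && (eps x == 0)) (fun x => #|L x|)).
move=> x /andP[x_neq0 /eqP eps_x] x_min.
have L_min s : s * x != 0 -> L (s * x) = L x.
  move=> sx0; apply/eqP; rewrite eqEcard x_min ?andbT; last first.
    by rewrite sx0 rmorphM eps_x mulr0 eqxx.
  by apply/subsetP => _ /imsetP[t _ ->]; rewrite mulrA.
have [g xgx] := span_semiprime x_neq0.
(* [z] lies in [S x = S (x z)], so [z = s x z] for some [s]; the idempotent is [s * x], a left
   identity for [z]. *)
pose z := f g * x; have xz : x * z = x * f g * x by rewrite mulrA.
have /imsetP[s _ z_eq] : z \in L (x * z) by rewrite xz L_min ?LP.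
have ez : s * x * z = z by rewrite -mulrA -z_eq.
exists (s * x); split.
- by apply: contra_neq xgx => sx0; rewrite -xz -ez sx0 mul0r mulr0.
(* For [e = s * x], the defect [e * e - e] kills [z]. Were it nonzero, it would generate [S x],
   giving [x * z = 0]. *)
- apply/eqP/negPn/negP; rewrite -subr_eq0 => d0.
  have dx : s * x * (s * x) - s * x = (s * x * s - s) * x by rewrite mulrBl !mulrA.
  have /imsetP[t _ x_eq] : x \in L (s * x * (s * x) - s * x).
    by rewrite dx L_min -?dx // -[X in X \in _]mul1r LP.
  case/eqP: xgx; rewrite -xz x_eq -mulrA mulrBl.
  by rewrite -[s * x * (s * x) * z]mulrA !ez subrr mulr0.
- by rewrite rmorphM eps_x mulr0.
(* By minimality a nonzero element of [e S e] generates [S x], which contains [e]. *)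
- move=> y y0; have /imsetP[t _ t_eq] : s * x \in L (s * x * y * (s * x)).
    by rewrite mulrA L_min ?LP // -mulrA.
  by exists t; rewrite -t_eq.
Qed.

(** * Matrix units over a division corner *)

Section MatrixUnits.
Variable e : S.
Hypotheses (e_neq0 : e != 0) (ee : e * e = e) (eps_e : eps e = 0).
Hypothesis e_inv : forall x, e * x * e != 0 -> exists y, y * (e * x * e) = e.

(** Left inverses rule out zero divisors in [e S e], which is therefore commutative. *)
Lemma span_cornerC x y :
  e * x * e = x -> e * y * e = y -> x * y = y * x.
Proof.
move=> xP yP; apply: (corner_mulC e_neq0 ee); rewrite ?/corner ?xP ?yP //.
move=> u v /eqP uP /eqP vP uv0; have [->|u0] := eqVneq u 0; first by left.
have [|w] := e_inv (x := u); rewrite uP // => wu.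
by right; rewrite -vP -wu -!mulrA (mulrA u) uv0 mul0r mulr0.
Qed.

(* [a i * b j] is the matrix unit of index (i, j) over the ring [e S e]. *)
Definition mx_units n (a b : nat -> S) :=
  [/\ forall i, (i < n)%N -> a i * e = a i,
      forall i, (i < n)%N -> e * b i = b i &
      forall i j, (i < n)%N -> (j < n)%N -> b i * a j = if i == j then e else 0].

Definition mx_one n (a b : nat -> S) := \sum_(i < n) a i * b i.

Section MxUnitsTheory.
Variables (n : nat) (a b : nat -> S).
Hypothesis ab : mx_units n a b.
Local Notation E := (mx_one n a b).

Lemma mx_oneMl i : (i < n)%N -> E * a i = a i.
Proof.
have [ae _ ba] := ab => lt_in; rewrite mulr_suml (bigD1 (Ordinal lt_in)) //=.
rewrite -mulrA ba // eqxx ae // big1 ?addr0 // => j /negPf j_neq.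
by rewrite -mulrA ba // -[j == i :> nat]/(j == Ordinal lt_in) j_neq mulr0.
Qed.

Lemma mx_oneMr i : (i < n)%N -> b i * E = b i.
Proof.
have [_ eb ba] := ab => lt_in; rewrite mulr_sumr (bigD1 (Ordinal lt_in)) //=.
rewrite mulrA ba // eqxx eb // big1 ?addr0 // => j /negPf j_neq.
by rewrite mulrA ba // eq_sym -[j == i :> nat]/(j == Ordinal lt_in) j_neq mul0r.
Qed.

Lemma mx_one_idem : E * E = E.
Proof. by rewrite {2 3}/mx_one mulr_sumr; apply: eq_bigr => i _; rewrite mulrA mx_oneMl. Qed.

Lemma mx_cone_idem : (1 - E) * (1 - E) = 1 - E.
Proof. by rewrite mulrBr mulr1 [_ * E]mulrBl mul1r mx_one_idem subrr subr0. Qed.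

(** For [y = (1 - E) * s * e], semiprimeness gives [g] with [e * f g * y] nonzero. Its left inverse
    yields [z] in [S (1 - E)] with [z * y = e]; since [1 - E] kills the old units, [y] and [z]
    extend the system. *)
Lemma mx_units_extend s :
  (1 - E) * s * e != 0 -> exists a' b', mx_units n.+1 a' b'.
Proof.
have [ae eb ba] := ab; set y := _ * e => y0.
have ye : y * e = y by rewrite /y -mulrA ee.
have Fy : (1 - E) * y = y.
  by rewrite /y !mulrA mx_cone_idem.
have [g ygy] := span_semiprime y0.
have [|c cety] := e_inv (x := f g * (1 - E) * s).
  have etyE : e * (f g * (1 - E) * s) * e = e * f g * y by rewrite /y !mulrA.
  rewrite etyE; apply: contra_neq ygy => ety0.
  by rewrite -[X in X * f g]ye -(mulrA y) -(mulrA y) ety0 mulr0.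
pose z := e * c * e * f g * (1 - E).
have zy : z * y = e.
  have cy : c * (e * f g * y) = e by rewrite -[RHS]cety /y !mulrA.
  by rewrite /z -mulrA Fy -[RHS]ee -[X in _ = _ * X]cy !mulrA.
have Fa i : (i < n)%N -> (1 - E) * a i = 0.
  by move=> lt_in; rewrite mulrBl mul1r mx_oneMl ?subrr.
have bF i : (i < n)%N -> b i * (1 - E) = 0.
  by move=> lt_in; rewrite mulrBr mulr1 mx_oneMr ?subrr.
exists (fun i => if (i < n)%N then a i else y), (fun i => if (i < n)%N then b i else z).
split=> [i _|i _|i j]; rewrite ?ltnS.
- by case: ifP => // /ae.
- by case: ifP => [/eb//|_]; rewrite /z !mulrA ee.
move=> le_in le_jn.
case: ltnP => lt_in; case: ltnP => lt_jn; first exact: ba.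
- by rewrite -Fy mulrA bF // mul0r ltn_eqF ?(leq_trans lt_in).
- by rewrite -mulrA Fa // mulr0 gtn_eqF ?(leq_trans lt_jn).
- have -> : i = n by apply/eqP; rewrite eqn_leq le_in.
  by have -> : j = n; [apply/eqP; rewrite eqn_leq le_jn | rewrite eqxx].
Qed.

End MxUnitsTheory.

(** The [a i] are distinct, because [b i * a i = e] is nonzero and [b i * a j = 0] otherwise; so
    there are at most [#|S|] of them and extension must stop. *)
Lemma mx_units_max : exists n a b,
  mx_units n a b /\ forall s, (1 - mx_one n a b) * s * e = 0.
Proof.
suff /(_ #|S|.+1)[//|[a [b [ae _ ba]]]] : forall n,
    (exists n a b, mx_units n a b /\ forall s, (1 - mx_one n a b) * s * e = 0)
    \/ exists a b, mx_units n a b.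
  have /leq_card : injective (fun i : 'I_#|S|.+1 => a i).
    move=> i j aij; apply/val_inj/eqP.
    have := ba i j (ltn_ord i) (ltn_ord j); rewrite -aij ba // eqxx.
    by case: eqP => // _ /eqP; rewrite (negPf e_neq0).
  by rewrite card_ord ltnn.
elim=> [|n [[IH]|[a [b ab]]]]; first by right; exists (fun=> 0), (fun=> 0); split.
  by left; exists IH.
case: (boolP [exists s, (1 - mx_one n a b) * s * e != 0]).
  by case/existsP => s /(mx_units_extend ab); right.
move/existsPn => abE; left; exists n, a, b; split=> // s.
exact/eqP/negPn/abE.
Qed.

(** * The full matrix ring cut out by a maximal system *)

Section MxUnitsMax.
Variables (n : nat) (a b : nat -> S).
Hypothesis ab : mx_units n a b.
Local Notation E := (mx_one n a b).
Hypothesis abE : forall s, (1 - E) * s * e = 0.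

Let ae (i : 'I_n) : a i * e = a i. Proof. by case: ab => + _ _; apply. Qed.
Let eb (i : 'I_n) : e * b i = b i. Proof. by case: ab => _ + _; apply. Qed.
Let ba (i j : 'I_n) : b i * a j = if i == j then e else 0.
Proof. by case: ab => _ _; apply. Qed.
Let Ea (i : 'I_n) : E * a i = a i. Proof. exact: (mx_oneMl ab). Qed.
Let bE (i : 'I_n) : b i * E = b i. Proof. exact: (mx_oneMr ab). Qed.
Let EE : E * E = E. Proof. exact: (mx_one_idem ab). Qed.

(** A nonzero value [w] would satisfy [w * f g * w != 0] for some [g], but this product has a factor
    in [(1 - E) S e = 0]. *)
Let abE_sym s : e * s * (1 - E) = 0.
Proof.
apply/eqP/idPn => /span_semiprime[g].
have -> : e * s * (1 - E) * f g * (e * s * (1 - E)) =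
          e * s * ((1 - E) * f g * e) * (s * (1 - E)) by rewrite !mulrA.
by rewrite abE mulr0 mul0r eqxx.
Qed.

(** Both Peirce components [(1 - E) S E] and [E S (1 - E)] vanish, since [E] is a sum of products
    through [e]. *)
Lemma mx_one_central s : E * s = s * E.
Proof.
have sE : (1 - E) * s * E = 0.
  rewrite {2}/mx_one mulr_sumr big1 // => i _.
  by rewrite -[X in X * b i]ae !mulrA -[_ * s * a i]mulrA abE mul0r.
have Es : E * s * (1 - E) = 0.
  rewrite {1}/mx_one !mulr_suml big1 // => i _.
  by rewrite -[X in a i * X]eb -!mulrA (mulrA (b i)) (mulrA e) abE_sym mulr0.
move/eqP: Es; rewrite mulrBr mulr1 subr_eq0 => /eqP ->.
by move/eqP: sE; rewrite mulrBl mul1r mulrBl subr_eq0 => /eqP ->.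
Qed.

(** Otherwise, with [e] written as a sum over [X], [eps e = 0] makes [#|X|] even, whence
    [e = E * e = #|X| E = 0]. *)
Let E_neq_f : exists g, E * f g != E.
Proof.
case: (boolP [exists g, E * f g != E]) => [/existsP //|/existsPn Ef].
have {}Ef g : E * f g = E by apply/eqP/negPn.
have Ee : E * e = e.
  by have := abE 1; rewrite mulr1 mulrBl mul1r => /eqP; rewrite subr_eq0 => /eqP.
have [X eX] := f_span e; case/eqP: e_neq0.
have : eps e = #|X|%:R.
  rewrite eX rmorph_sum (eq_bigr (fun=> 1)) => [|g _]; last exact: eps_f.
  by rewrite sumr_const.
have eps2 : 2%:R = 0 :> R by rewrite -(rmorph_nat eps) [2%:R]two0 rmorph0.
rewrite eps_e -[#|X|]odd_double_half -muln2 natrD natrM eps2 mulr0 addr0.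
have [X_odd /eqP|X_even _] := boolP (odd #|X|); first by rewrite eq_sym (negPf R_neq0).
rewrite -Ee eX mulr_sumr (eq_bigr (fun=> E)) => [|g _]; last exact: Ef.
rewrite sumr_const -mulr_natr -[#|X|]odd_double_half (negPf X_even).
by rewrite -muln2 natrM [2%:R]two0 !mulr0.
Qed.

(** [S] is the product of [E S] and [(1 - E) S], so a unit of the first factor is completed by the
    identity of the second. *)
Lemma mx_unit_lift u v :
  E * u = u -> E * v = v -> u * v = E -> v * u = E -> exists g, f g = u + (1 - E).
Proof.
move=> Eu Ev uv vu.
have prod x y : E * x = x -> E * y = y -> x * y = E -> (x + (1 - E)) * (y + (1 - E)) = 1.
  move=> Ex Ey xy.
  have xF : x * (1 - E) = 0 by rewrite mulrBr mulr1 -mx_one_central Ex subrr.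
  have Fy : (1 - E) * y = 0 by rewrite mulrBl mul1r Ey subrr.
  have EF : E + (1 - E) = 1 by rewrite addrC subrK.
  move: (1 - E) (mx_cone_idem ab) xF Fy EF => F FF xF Fy EF.
  by rewrite mulrDl !mulrDr xy xF Fy FF addr0 add0r.
by apply: (f_unit (prod u v Eu Ev uv) (prod v u Ev Eu vu)).
Qed.

(** The elements acting trivially on [(1 - E) S] form a normal subgroup. It contains the lift of
    some [E * f h] distinct from [E], so it is the whole group. *)
Lemma mx_cone_f g : (1 - E) * f g = 1 - E.
Proof.
pose H := [set g | (1 - E) * f g == 1 - E].
have gH : group_set H.
  apply/group_setP; split=> [|x y]; first by rewrite inE f1 mulr1.
  by rewrite !inE fM mulrA => /eqP-> /eqP->.
have nH : Group gH <| [set: gT].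
  have FC s : (1 - E) * s = s * (1 - E).
    by rewrite mulrBl mulrBr mul1r mulr1 mx_one_central.
  rewrite /normal subsetT; apply/subsetP => x _; rewrite inE.
  apply/subsetP => _ /imsetP[y + ->]; rewrite !inE => /eqP yH.
  by rewrite conjgE !fM !mulrA FC -(mulrA _ _ (f y)) yH -mulrA FC mulrA -fM mulVg f1 mul1r.
have [h Eh] := E_neq_f.
have EM x y : (E * f x) * (E * f y) = E * f (x * y)%g.
  by rewrite mulrA -[E * f x * E]mulrA -mx_one_central !mulrA EE fM -mulrA.
have EEf x : E * (E * f x) = E * f x by rewrite mulrA EE.
have [||k fk] := mx_unit_lift (EEf h) (EEf h^-1%g).
- by rewrite EM mulgV f1 mulr1.
- by rewrite EM mulVg f1 mulr1.
have kH : k \in Group gH.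
  by rewrite inE fk mulrDr (mx_cone_idem ab) mulrA mulrBl mul1r EE subrr mul0r add0r.
have k1 : k != 1%g.
  apply: contra_neq Eh => k1; apply: (addIr (1 - E)).
  by rewrite -fk k1 f1 addrC subrK.
have /setP/(_ g) := simple_normal_neq1 gT_simple nH kH k1.
by rewrite !inE => /eqP.
Qed.

Let sum_ba (i : 'I_n) (F : 'I_n -> S) : \sum_(j < n) b i * a j * F j = e * F i.
Proof.
rewrite (bigD1 i) //= ba eqxx big1 ?addr0 // => j j_neq.
by rewrite ba eq_sym ifN ?mul0r.
Qed.

Let entry_corner s (i j : 'I_n) : e * (b i * s * a j) * e = b i * s * a j.
Proof. by rewrite !mulrA eb -[LHS]mulrA ae. Qed.

Lemma mx_one_mul_sum s : E * s = \sum_(i < n) \sum_(j < n) a i * (b i * s * a j) * b j.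
Proof.
have -> : E * s = E * s * E by rewrite -mulrA -mx_one_central mulrA EE.
rewrite {1}/mx_one !mulr_suml; apply: eq_bigr => i _; rewrite mulr_sumr.
by apply: eq_bigr => j _; rewrite !mulrA.
Qed.

(* The scalar matrix of [d], completed by [1 - E], is a central unit. *)
Lemma span_corner_trivial d : e * d * e = d -> d != 0 -> d = e.
Proof.
move=> dP d_neq0.
pose c x := \sum_(i < n) a i * x * b i.
have cM x y : e * x * e = x -> e * y * e = y -> c x * c y = c (x * y).
  move=> xP yP; have xe : x * e = x by rewrite -xP -!mulrA ee.
  rewrite {1}/c mulr_suml; apply: eq_bigr => i _.
  have <- : \sum_(j < n) a i * x * (b i * a j * (y * b j)) = a i * x * b i * c y.
    by rewrite mulr_sumr; apply: eq_bigr => j _; rewrite !mulrA.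
  by rewrite -mulr_sumr sum_ba !mulrA -(mulrA _ x e) xe.
have Ec x : E * c x = c x.
  by rewrite mulr_sumr; apply: eq_bigr => i _; rewrite !mulrA Ea.
have ce : c e = E by apply: eq_bigr => i _; rewrite ae.
have ed : e * d = d by rewrite -dP !mulrA ee.
have de : d * e = d by rewrite -dP -!mulrA ee.
have [|d' d'd] := e_inv (x := d); first by rewrite dP.
(* Compressing [d'] puts the inverse inside [e S e], where commutativity makes it two-sided. *)
rewrite dP in d'd; pose d1 := e * d' * e.
have d1P : e * d1 * e = d1 by rewrite /d1 !mulrA ee -mulrA ee.
have d1d : d1 * d = e.
  by rewrite /d1 -!mulrA ed d'd ee.
have dd1 : d * d1 = e by rewrite (span_cornerC dP d1P).
have [||z fz] := mx_unit_lift (Ec d) (Ec d1).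
- by rewrite cM // dd1.
- by rewrite cM // d1d.
(* [d] commutes with all matrix entries and [E] is central. *)
have cC s : c d * s = s * c d.
  transitivity (\sum_(i < n) \sum_(j < n) a i * d * (b i * s * a j) * b j).
    rewrite mulr_suml; apply: eq_bigr => i _.
    have bsE : b i * s = b i * s * E by rewrite -mulrA -mx_one_central mulrA bE.
    rewrite -mulrA [in LHS]bsE /mx_one !mulr_sumr; apply: eq_bigr => j _.
    by rewrite !mulrA.
  have -> : s * c d = E * s * c d by rewrite mx_one_central -mulrA Ec.
  rewrite /mx_one 2!mulr_suml; apply: eq_bigr => i _.
  rewrite mulr_sumr; apply: eq_bigr => j _; rewrite -!(mulrA (a i)).
  by rewrite (span_cornerC dP (entry_corner s i j)) !mulrA.
have z1 : z = 1%g.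
  apply: (nonabelian_simple_center gT_simple gT_nab) => g; apply: f_inj.
  by rewrite !fM fz mulrDl mulrDr cC mulrBl mulrBr mul1r mulr1 mx_one_central.
have cd : c d = E.
  by apply: (addIr (1 - E)); rewrite -fz z1 f1 addrC subrK.
have [g Eg] := E_neq_f.
(* An empty system would have [E = 0], against [E * f g != E]. *)
have n_gt0 : (0 < n)%N.
  rewrite ltnNge; apply: contra Eg => n_le0.
  have -> : E = 0; last by rewrite mul0r.
  by rewrite /mx_one big1 // => i _; have := leq_trans (ltn_ord i) n_le0.
pose i := Ordinal n_gt0.
transitivity (b i * c d * a i); last by rewrite cd bE ba eqxx.
transitivity (\sum_(j < n) b i * a j * (d * (b j * a i))).
  by rewrite sum_ba ba eqxx de ed.
by rewrite mulr_sumr mulr_suml; apply: eq_bigr => j _; rewrite !mulrA.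
Qed.

(** As [e S e] contains only 0 and [e], and the component in [(1 - E) S] is fixed, [g] is determined
    by a boolean matrix of size [n]; hence [16 < 2 ^ (n ^ 2)]. *)
Lemma mx_units_ge3 : (2 < n)%N.
Proof.
pose m g := [ffun p : 'I_n * 'I_n => b p.1 * f g * a p.2 == e].
have m_inj : injective m.
  move=> g h /ffunP gh; apply: f_inj.
  suff EfE : E * f g = E * f h.
    by rewrite -[f g]mul1r -[f h]mul1r -(subrK E 1) !(mulrDl _ E) !mx_cone_f EfE.
  rewrite !mx_one_mul_sum; apply: eq_bigr => i _; apply: eq_bigr => j _.
  congr (_ * _ * _); have := gh (i, j); rewrite !ffunE /=.
  have [-> /esym/eqP-> //|ng] := eqVneq (b i * f g * a j) e.
  have [-> //|nh _] := eqVneq (b i * f h * a j) e.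
  have corner0 k : b i * f k * a j != e -> b i * f k * a j = 0.
    by move=> nk; apply: contra_neq_eq nk; apply: span_corner_trivial; apply: entry_corner.
  by rewrite (corner0 g ng) (corner0 h nh).
have := leq_trans (nonabelian_simple_card_gt16 gT_simple gT_nab) (leq_card m m_inj).
rewrite card_ffun card_bool card_prod card_ord.
by move: (n) => [|[|[|]]].
Qed.

(** Transposition of the matrix of [E * s]. *)
Let tau s := \sum_(i < n) \sum_(j < n) a i * (b j * s * a i) * b j.

Let tauD s t : tau (s + t) = tau s + tau t.
Proof.
rewrite /tau -big_split; apply: eq_bigr => i _.
rewrite -big_split; apply: eq_bigr => j _.
by rewrite mulrDr mulrDl mulrDr mulrDl.
Qed.

Let tau1 : tau 1 = E.
Proof.
apply: eq_bigr => i _; rewrite (bigD1 i) //= mulr1 ba eqxx ae big1 ?addr0 // => j j_neq.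
by rewrite mulr1 ba ifN // mulr0 mul0r.
Qed.

(** Transposition reverses products because the entries commute. *)
Let tauM s t : tau (s * t) = tau t * tau s.
Proof.
rewrite {2}/tau mulr_suml; apply: eq_bigr => i _.
transitivity (\sum_(k < n) \sum_(j < n)
    a i * (b k * t * a i) * (b j * s * a k) * b j).
  rewrite exchange_big; apply: eq_bigr => j _.
  transitivity (a i * (b j * s * (E * t) * a i) * b j).
    by rewrite !mulrA -(mulrA _ s E) -mx_one_central !mulrA -(mulrA _ (b j) E) bE.
  rewrite /mx_one mulr_suml !mulr_sumr mulr_suml mulr_sumr mulr_suml.
  apply: eq_bigr => k _; rewrite -(mulrA (a i) (b k * t * a i)).
  by rewrite (span_cornerC (entry_corner _ _ _) (entry_corner _ _ _)) !mulrA.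
rewrite mulr_suml; apply: eq_bigr => k _; rewrite /tau mulr_sumr.
transitivity (\sum_(l < n) a i * (b k * t * a i) * (b k * a l *
    \sum_(j < n) (b j * s * a l) * b j)).
  rewrite -mulr_sumr sum_ba !mulr_sumr; apply: eq_bigr => j _.
  by rewrite !mulrA -(mulrA _ (a i) e) ae.
apply: eq_bigr => l _; rewrite !mulr_sumr; apply: eq_bigr => j _.
by rewrite !mulrA.
Qed.

Let tau_unit (i j : 'I_n) : tau (a i * b j) = a j * b i.
Proof.
rewrite /tau (bigD1 j) //= [X in _ + X]big1 ?addr0 => [|k k_neq]; last first.
  rewrite big1 // => l _; rewrite !mulrA -[_ * b j * a k]mulrA ba ifN 1?eq_sym //.
  by rewrite !mulr0 mul0r.
rewrite (bigD1 i) //= [X in _ + X]big1 ?addr0 => [|k k_neq]; last first.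
  by rewrite !mulrA -[a j * b k * a i]mulrA ba ifN // mulr0 !mul0r.
by rewrite !mulrA -(mulrA _ (b i) (a i)) ba eqxx ae -(mulrA _ (b j)) ba eqxx ae.
Qed.

(* [theta] is the transpose-inverse automorphism, and [A], [B], [C] are
   [1 + e12], [1 + e23] and [1 + e12 + e23]. *)
Lemma span_transpose_inverse : exists2 theta : gT -> gT,
    {morph theta : g h / (g * h)%g} &
    exists A B C, 1 + f A + f B + f C = 0 /\
                  1 + f (theta A) + f (theta B) + f (theta C) != 0.
Proof.
have Etau s : E * tau s = tau s.
  rewrite mulr_sumr; apply: eq_bigr => i _; rewrite mulr_sumr.
  by apply: eq_bigr => j _; rewrite !mulrA Ea.
have tau_f g h : tau (f g) * tau (f h) = tau (f (h * g)%g) by rewrite fM tauM.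
(* The transpose of the inverse, completed by [1 - E], is a unit of [S] and so comes from the
   group. *)
have rho_f g : exists h, f h == tau (f g^-1%g) + (1 - E).
  have [||||h fh] := @mx_unit_lift (tau (f g^-1%g)) (tau (f g)).
  - exact: Etau.
  - exact: Etau.
  - by rewrite tau_f mulgV f1 tau1.
  - by rewrite tau_f mulVg f1 tau1.
  - by exists h; rewrite fh.
pose theta g := xchoose (rho_f g).
have f_theta g : f (theta g) = tau (f g^-1%g) + (1 - E).
  exact/eqP/(xchooseP (rho_f g)).
exists theta => [g h|].
  apply: f_inj; rewrite fM !f_theta invMg -tau_f.
  move: (Etau (f g^-1%g)) (Etau (f h^-1%g)).
  move: (tau (f g^-1%g)) (tau (f h^-1%g)) => x y Ex Ey.
  have xF : x * (1 - E) = 0 by rewrite mulrBr mulr1 -mx_one_central Ex subrr.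
  have Fy : (1 - E) * y = 0 by rewrite mulrBl mul1r Ey subrr.
  rewrite mulrDl [x * (_ + _)]mulrDr [(1 - E) * (_ + _)]mulrDr xF Fy.
  by rewrite (mx_cone_idem ab) addr0 add0r.
have f_theta1 g x : f g^-1%g = 1 + x -> f (theta g) = 1 + tau x.
  by move=> fg; rewrite f_theta fg tauD tau1 addrAC (addrC E) subrK.
have fV g x : f g * x = 1 -> f g^-1%g = x.
  by move=> gx; rewrite -[LHS]mulr1 -gx mulrA -fM mulVg f1 mul1r.
have lt_n k : (k < 3)%N -> (k < n)%N by move/leq_trans; apply; exact: mx_units_ge3.
pose o1 := Ordinal (lt_n 0 isT); pose o2 := Ordinal (lt_n 1 isT).
pose o3 := Ordinal (lt_n 2 isT).
have unitM (i j k l : 'I_n) : a i * b j * (a k * b l) = if j == k then a i * b l else 0.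
  rewrite mulrA -[a i * b j * a k]mulrA ba.
  by case: ifP => _; rewrite ?ae // mulr0 mul0r.
pose x := a o1 * b o2; pose y := a o2 * b o3; pose z := a o1 * b o3.
have [xx yy yx xy] : [/\ x * x = 0, y * y = 0, y * x = 0 & x * y = z].
  by rewrite /x /y /z !unitM.
have [xz zx yz zy] : [/\ x * z = 0, z * x = 0, y * z = 0 & z * y = 0].
  by rewrite /x /y /z !unitM.
have sq1 (u : S) : u * u = 0 -> (1 + u) * (1 + u) = 1.
  by move=> uu; rewrite mulrDl mul1r mulrDr mulr1 uu addr0 -addrA span_addxx addr0.
have [A fA] := f_unit (sq1 x xx) (sq1 x xx).
have [B fB] := f_unit (sq1 y yy) (sq1 y yy).
have nn : (x + y) * (x + y) = z.
  by rewrite mulrDl !mulrDr xx yy yx xy addr0 add0r addr0.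
have nz : (x + y) * z = 0 by rewrite mulrDl xz yz addr0.
have zn : z * (x + y) = 0 by rewrite mulrDr zx zy addr0.
(* With [v = x + y], [v ^ 2 = z] and [v ^ 3 = 0], the inverse of [1 + v] is [1 + v + z]. *)
have CV : (1 + (x + y)) * (1 + (x + y + z)) = 1.
  move: (x + y) nn nz => v vv vz.
  rewrite mulrDl mul1r mulrDr mulr1 mulrDr vv vz addr0.
  by rewrite -addrA [X in 1 + X]span_addxx addr0.
have VC : (1 + (x + y + z)) * (1 + (x + y)) = 1.
  move: (x + y) nn zn => v vv zv.
  rewrite mulrDr mulr1 mulrDl mul1r mulrDl vv zv addr0.
  by rewrite -addrA [X in 1 + X]span_addxx addr0.
have [C fC] := f_unit CV VC.
exists A, B, C; rewrite fA fB fC.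
rewrite (f_theta1 A x) ?(f_theta1 B y) ?(f_theta1 C (x + y + z)); first last.
- by apply: fV; rewrite fA sq1.
- by apply: fV; rewrite fB sq1.
- by apply: fV; rewrite fC.
(* The original relation is the case [w = 0]. Inverting [C] contributes [z], so the images under
   [theta] leave [w = tau z], a matrix unit. *)
have cancel (u v w : S) : 1 + (1 + u) + (1 + v) + (1 + (u + v + w)) = w.
  rewrite !addrA (ACl ((1*2)*(4*6)*(3*7)*(5*8)*9)) /=.
  by rewrite !span_addxx !add0r.
split; first by have := cancel x y 0; rewrite addr0.
rewrite !tauD cancel /z tau_unit; apply: contra_neq e_neq0 => ab0.
have := mulr0 (b o3); rewrite -[X in _ * X]ab0 => /(congr1 ( *%R ^~ (a o1))).
by rewrite mul0r !mulrA ba eqxx -mulrA ba eqxx ee.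
Qed.

End MxUnitsMax.

End MatrixUnits.

Lemma broken_relation : exists2 theta : gT -> gT,
    {morph theta : g h / (g * h)%g} &
    exists A B C, 1 + f A + f B + f C = 0 /\
                  1 + f (theta A) + f (theta B) + f (theta C) != 0.
Proof.
have [e [e_neq0 ee eps_e e_inv]] := span_idempotent.
have [n [a [b [ab abE]]]] := mx_units_max e_neq0 ee e_inv.
exact: (span_transpose_inverse e_neq0 ee eps_e e_inv ab abE).
Qed.

End UnitSpan.

(** * The span of the units *)

Section FiniteSpan.
Variables (gT : finGroupType) (R : pzRingType) (u : gT -> R).
Hypotheses (u1 : u 1%g = 1) (uM : {morph u : g h / (g * h)%g >-> g * h}).
Hypothesis two0 : 1 + 1 = 0 :> R.

Definition set_sum (X : {set gT}) : R := \sum_(g in X) u g.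
(** In characteristic 2 repeated terms cancel, so subset sums exhaust the additive span. *)
Definition in_span : pred R := fun x => [exists X, x == set_sum X].

Let addxx (x : R) : x + x = 0.
Proof. by rewrite -[x]mul1r -mulrDl two0 mul0r. Qed.

Lemma in_spanP x : reflect (exists X, x = set_sum X) (in_span x).
Proof. by apply: (iffP existsP) => -[X /eqP]; exists X => //; apply/eqP. Qed.

Fact in_span_subring : subring_closed in_span.
Proof.
have oppxx (x : R) : - x = x by apply/eqP; rewrite -subr_eq0 -opprD addxx oppr0.
have span0 : in_span 0 by apply/in_spanP; exists set0; rewrite /set_sum big_set0.
have spanD x y : in_span x -> in_span y -> in_span (x + y).
  move=> /in_spanP[X ->] /in_spanP[Y ->]; apply/in_spanP.
  exists ((X :\: Y) :|: (Y :\: X)); rewrite /set_sum.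
  rewrite ![\sum_(_ in _) _]big_mkcond -big_split; apply: eq_bigr => g _.
  rewrite !inE; case: (g \in X); case: (g \in Y) => /=;
    by rewrite ?addr0 ?add0r ?addxx.
split=> [|x y xS yS|x y].
- by apply/in_spanP; exists [set 1%g]; rewrite /set_sum big_set1 u1.
- by rewrite -[- y]oppxx opprK; apply: spanD.
move=> /in_spanP[X ->] /in_spanP[Y ->]; rewrite {2}/set_sum mulr_sumr.
apply: (big_ind in_span) => // h _; apply/in_spanP; exists (X :* h)%g.
rewrite /set_sum mulr_suml -rcosetE /rcoset big_imset /=.
  by apply: eq_bigr => g _; rewrite uM.
by move=> g k _ _; apply: mulIg.
Qed.

(* The proofs are arguments so that the ring structure below can be inferred. *)
Definition span_ring of u 1%g = 1 & {morph u : g h / (g * h)%g >-> g * h} &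
  1 + 1 = 0 :> R := {x | in_span x}.
Local Notation spanT := (span_ring u1 uM two0).
HB.instance Definition _ := SubChoice.copy spanT {x | in_span x}.
HB.instance Definition _ := 
  GRing.SubChoice_isSubPzRing.Build R in_span spanT in_span_subring.

(** Choosing a representing subset for each element embeds the span in a finite type. *)
Let supp (x : spanT) : {set gT} := xchoose (existsP (valP x)).
Let of_supp (X : {set gT}) : spanT := insubd (0 : spanT) (set_sum X).
Fact suppK : cancel supp of_supp.
Proof.
move=> x; apply/val_inj; rewrite val_insubd.
have /eqP <- := xchooseP (existsP (valP x)).
by rewrite (valP x).
Qed.
HB.instance Definition _ := CanIsCountable suppK.
HB.instance Definition _ := isFinite.Build spanT (pcan_enumP (can_pcan suppK)).

End FiniteSpan.

(** A full realization stated on elements: [u] identifies [gT] with the units of [R], and group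
    endomorphisms are plain product-preserving maps. *)
Definition char2_realization (gT : finGroupType) (R : pzRingType) (u : gT -> R) :=
  [/\ u 1%g = 1, {morph u : g h / (g * h)%g >-> g * h}, injective u,
      forall x y, x * y = 1 -> y * x = 1 -> exists g, u g = x &
      1 + 1 = 0 :> R] /\
  forall phi : gT -> gT, {morph phi : g h / (g * h)%g} ->
    exists psi : {rmorphism R -> R}, forall g, psi (u g) = u (phi g).

(* The unit [-1] is fixed by ring endomorphisms, in particular by one that
   realizes the trivial endomorphism of the unit group; hence [-1 = 1]. *)
Lemma fully_realizable_char2 (gT : finGroupType) :
  fully_realizable gT -> exists (R : pzRingType) (u : gT -> R), char2_realization u.
Proof.
case=> R [f [f_bij f_end]]; exists R, (fun g => uval (f g)).
have f1 : f 1%g = 1%g by apply: (mulgI (f 1%g)); rewrite -gmulfM !mulg1.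
have f_lift x y : x * y = 1 -> y * x = 1 -> exists g, uval (f g) = x.
  move=> xy yx; have [|v <-] := (uvalP x).2; first by exists y.
  by case: f_bij => f' fK f'K; exists (f' v); rewrite f'K.
have lift_end (phi : gT -> gT) : {morph phi : g h / (g * h)%g} ->
    exists psi : {rmorphism R -> R}, forall g, psi (uval (f g)) = uval (f (phi g)).
  move=> phiM; pose phiP := isMultiplicative.Build gT gT phi phiM.
  pose phi' : {multiplicative gT -> gT} := HB.pack phi phiP.
  by have [psi psiP] := f_end phi'; exists psi => g; rewrite (psiP g).
split=> //; split=> // [|g h|g h /uval_inj/(bij_inj f_bij) //|].
- by rewrite f1.
- by rewrite gmulfM.
have [|psi psi1] := lift_end (fun=> 1%g); first by move=> g h; rewrite mulg1.
have [||g ug] := f_lift (-1) (-1); rewrite ?mulrNN ?mulr1 //.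
have := psi1 g; rewrite ug f1 rmorphN rmorph1 => N1.
by rewrite -[X in X + _](N1 : _ = 1) addNr.
Qed.

(** On the span, the ring endomorphism realizing the trivial map is an augmentation; one realizing
    the transpose-inverse would preserve the relation that this map breaks. *)
Lemma fully_realizable_simple_abelian (gT : finGroupType) :
  simple [set: gT] -> fully_realizable gT -> abelian [set: gT].
Proof.
move=> gT_simple /fully_realizable_char2[R [u [[u1 uM u_inj u_unit two0] u_end]]].
apply/idPn => gT_nab.
have [|eps eps_u] := u_end (fun=> 1%g); first by move=> g h; rewrite mulg1.
have R_neq0 : 1 != 0 :> R.
  have [ntG _] := simpleP _ gT_simple; have [g _ g1] := trivgPn _ ntG.
  apply: contra_neq g1 => one0; apply: u_inj.
  by rewrite -[u g]mul1r -[RHS]mul1r one0 !mul0r.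
pose S := span_ring u1 uM two0.
have u_span g : in_span u (u g).
  by apply/in_spanP; exists [set g]; rewrite /set_sum big_set1.
pose f g : S := Sub (u g) (u_span g).
pose epsS : {rmorphism S -> R} := eps \o val.
have [||||||||theta thetaM [A [B [C [ABC ABC']]]]] :=
  @broken_relation gT (span_ring u1 uM two0) R f epsS gT_simple gT_nab.

- exact/val_inj.
- by move=> g h; apply/val_inj; rewrite /= uM.
- by move=> g h /(congr1 val)/u_inj.
- move=> x y /(congr1 val) /= xy /(congr1 val) /= yx.
  by have [g ug] := u_unit _ _ xy yx; exists g; apply/val_inj.
- move=> s; have /in_spanP[X sX] := valP s; exists X; apply/val_inj.
  by rewrite sX rmorph_sum.
- exact/val_inj.
- exact: R_neq0.
- by move=> g; rewrite /= eps_u.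
have [psi psi_u] := u_end theta thetaM.
case/eqP: ABC'; apply/val_inj => /=.
rewrite -!psi_u -[1](rmorph1 psi) -!rmorphD.
by have /= -> := congr1 val ABC; rewrite rmorph0.
Qed.

(** * Abelian groups of units *)

Section GeometricSum.
Variables (R : pzRingType) (x : R) (n : nat).
Hypotheses (two0 : 1 + 1 = 0 :> R) (xn1 : x ^+ n = 1).

Definition geom_sum m := \sum_(i < m) x ^+ i.

Lemma geom_sumD a b : geom_sum (a + b) = geom_sum a + x ^+ a * geom_sum b.
Proof.
rewrite /geom_sum big_split_ord mulr_sumr; congr (_ + _).
by apply: eq_bigr => i _; rewrite exprD.
Qed.

(** Two consecutive blocks of length [n] have equal sums, which cancel in characteristic 2. *)
Lemma geom_sum_period m : geom_sum (m * n.*2) = 0.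
Proof.
elim: m => [|m IHm]; first by rewrite /geom_sum big_ord0.
rewrite mulSn geom_sumD {}IHm mulr0 addr0 -addnn geom_sumD xn1 mul1r.
by rewrite -[geom_sum n]mul1r -mulrDl two0 mul0r.
Qed.

(* If [3 * k] is [1] modulo [2 * n], then the sum of the [x ^+ (3 * i)] for
   [i < k] is the inverse. *)
Lemma geom_sum3_unit : coprime n 6 ->
  exists y, geom_sum 3 * y = 1 /\ y * geom_sum 3 = 1.
Proof.
move=> n6; have cop : coprime 3 n.*2.
  by move: n6; rewrite -muln2 coprimeMr (coprime_sym 3 n) (@coprimeMr n 2 3) => /andP[_ ->].
have [[k m] /= km] := coprimeP n.*2 (isT : (0 < 3)%N) cop.
(* The Bezout relation uses truncated subtraction; its value 1 excludes truncation. *)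
have {}km : (k * 3 = 1 + m * n.*2)%N.
  by move: km; case: (leqP (k * 3) (m * n.*2)) => [/eqP->//|/ltnW/subnK]; move=> + km; rewrite km.
have sum1 : geom_sum (k * 3) = 1.
  by rewrite km geom_sumD geom_sum_period mulr0 addr0 /geom_sum big_ord1.
have comm3 j : x ^+ j * geom_sum 3 = geom_sum 3 * x ^+ j.
  rewrite mulr_suml mulr_sumr; apply: eq_bigr => i _.
  by rewrite -!exprD addnC.
(* Induction on [k]: [geom_sum 3] divides [geom_sum (k * 3)] on both sides with one cofactor. *)
rewrite -sum1; elim: k {km sum1} => [|k [y [sy ys]]].
  by exists 0; rewrite mulr0 mul0r /geom_sum big_ord0.
exists (y + x ^+ (k * 3)); rewrite mulrDl mulrDr sy ys -comm3.
by rewrite mulSn addnC geom_sumD.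
Qed.
End GeometricSum.

Lemma fully_realizable_abelian_coprime6 (gT : finGroupType) :
  abelian [set: gT] -> coprime #|gT| 6 -> fully_realizable gT ->
  forall g : gT, g = 1%g.
Proof.
move=> cGG n6 /fully_realizable_char2[R [u [[u1 uM u_inj u_unit two0] u_end]]] g.
have mulC (h k : gT) : (h * k)%g = (k * h)%g by apply: (centsP cGG); rewrite inE.
have sq_inj (h : gT) : (h * h)%g = 1%g -> h = 1%g.
  move=> hh; apply/eqP; rewrite -order_eq1 -dvdn1.
  have /eqP <- : coprime #|gT| 2 by apply: coprime_dvdr n6.
  by rewrite dvdn_gcd -cardsT order_dvdG ?inE // order_dvdn expgS expg1 hh eqxx.
have uX m : u g ^+ m = u (g ^+ m)%g.
  by elim: m => [|m IHm]; rewrite ?u1 // exprS expgS uM IHm.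
have xn1 : u g ^+ #|gT| = 1 by rewrite uX -cardsT expg_cardG ?inE // u1.
have [y [sy ys]] := geom_sum3_unit two0 xn1 n6.
have [h uh] := u_unit _ _ sy ys.
have {}uh : u h = 1 + u g + u (g * g)%g.
  by rewrite uh /geom_sum !big_ord_recr big_ord0 /= add0r expr0 expr1 expr2 uM.
have [|psi psi_u] := u_end (fun k => k^-1%g); first by move=> k l; rewrite invMg.
have hV : u h^-1%g = 1 + u g^-1%g + u (g^-1 * g^-1)%g.
  by rewrite -psi_u uh !rmorphD rmorph1 !psi_u invMg.
(* Multiplying [1 + g^-1 + g^-2] by [g^2] reverses the terms of [1 + g + g^2]. *)
have hg : (h^-1 * (g * g))%g = h.
  apply: u_inj; rewrite uM hV !mulrDl mul1r -!uM mulKg -mulgA mulKg mulVg u1 uh.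
  by rewrite addrC [u (g * g)%g + _]addrC addrA.
have /eqP : (g * h^-1)%g = 1%g.
  (* The square of [g * h^-1] is 1, and the group has odd order. *)
  by apply: sq_inj; rewrite mulgA [(g * h^-1 * g)%g]mulC mulgA [X in (X * _)%g]mulC hg mulgV.
rewrite -eq_mulgV1 => /eqP gh; rewrite -gh in uh.
apply: sq_inj; apply: u_inj; rewrite u1; apply: (addrI (1 + u g)).
by rewrite -uh [_ + 1]addrAC two0 add0r.
Qed.

(** * Group algebras over the field with two elements *)

Section GroupAlgebra.
Variable gT : finGroupType.

(* An alias, since [{ffun gT -> 'F_2}] already carries the pointwise product. *)
Definition galg := {ffun gT -> 'F_2}.
HB.instance Definition _ := GRing.Zmodule.copy galg {ffun gT -> 'F_2}.
Implicit Types a b c : galg.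

Definition gbasis (g : gT) : galg := [ffun x => (x == g)%:R].
Definition gconv a b : galg := [ffun x => \sum_y a y * b (y^-1 * x)%g].

Fact gconvA : associative gconv.
Proof.
move=> a b c; apply/ffunP => x; rewrite !ffunE.
transitivity (\sum_y \sum_z a y * b (y^-1 * z)%g * c (z^-1 * x)%g); last first.
  by rewrite exchange_big; apply: eq_bigr => z _; rewrite ffunE mulr_suml.
apply: eq_bigr => y _; rewrite ffunE mulr_sumr (reindex_inj (mulgI y^-1%g)).
by apply: eq_bigr => z _; rewrite mulrA invMg invgK -!mulgA mulKVg.
Qed.

Fact gconv_basisl g b : gconv (gbasis g) b = [ffun x => b (g^-1 * x)%g].
Proof.
apply/ffunP => x; rewrite !ffunE (bigD1 g) //= ffunE eqxx mul1r.
by rewrite big1 ?addr0 // => y /negPf y_neq; rewrite ffunE y_neq mul0r.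
Qed.

Fact gconv1l : left_id (gbasis 1%g) gconv.
Proof.
by move=> b; rewrite gconv_basisl; apply/ffunP => x; rewrite ffunE invg1 mul1g.
Qed.

Fact gconv1r : right_id (gbasis 1%g) gconv.
Proof.
move=> b; apply/ffunP => x; rewrite !ffunE (bigD1 x) //= ffunE mulVg eqxx mulr1.
rewrite big1 ?addr0 // => y y_neq.
by rewrite ffunE eq_sym eq_mulVg1 invg1 mul1g -eq_mulVg1 (negPf y_neq) mulr0.
Qed.

Fact gconvDl : left_distributive gconv +%R.
Proof.
move=> a b c; apply/ffunP => x; rewrite !ffunE -big_split.
by apply: eq_bigr => y _; rewrite ffunE mulrDl.
Qed.

Fact gconvDr : right_distributive gconv +%R.
Proof.
move=> a b c; apply/ffunP => x; rewrite !ffunE -big_split.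
by apply: eq_bigr => y _; rewrite ffunE mulrDr.
Qed.

HB.instance Definition _ := GRing.Zmodule_isPzRing.Build galg
  gconvA gconv1l gconv1r gconvDl gconvDr.

Lemma gbasisM g h : gbasis (g * h)%g = gbasis g * gbasis h.
Proof.
rewrite [RHS]gconv_basisl; apply/ffunP => x; rewrite !ffunE.
by rewrite -[in RHS](inj_eq (mulgI g)) mulKVg.
Qed.

Lemma gbasis_inj : injective gbasis.
Proof.
by move=> g h /ffunP/(_ g); rewrite !ffunE eqxx; case: eqP.
Qed.

Lemma gunit_subproof g :
  let p := (gbasis g, gbasis g^-1%g) in (p.1 * p.2 == 1) && (p.2 * p.1 == 1).
Proof. by rewrite /= -!gbasisM mulgV mulVg eqxx. Qed.
Definition gunit g : units galg := Units (gunit_subproof g).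

Fact gunit_is_multiplicative : {morph gunit : g h / (g * h)%g}.
Proof. by move=> g h; apply/uval_inj/gbasisM. Qed.
HB.instance Definition _ :=
  isMultiplicative.Build gT (units galg) gunit gunit_is_multiplicative.

Section Functoriality.
Variable phi : {multiplicative gT -> gT}.

Definition galg_map a : galg := [ffun x => \sum_(y | phi y == x) a y].

Fact galg_map_is_zmod_morphism : zmod_morphism galg_map.
Proof.
move=> a b; apply/ffunP => x; rewrite !ffunE -sumrB.
by apply: eq_bigr => y _; rewrite !ffunE.
Qed.
HB.instance Definition _ :=
  GRing.isZmodMorphism.Build galg galg galg_map galg_map_is_zmod_morphism.

Lemma galg_map_basis g : galg_map (gbasis g) = gbasis (phi g).
Proof.
apply/ffunP => x; rewrite !ffunE eq_sym; case: eqP => [<-|phi_neq].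
  rewrite (bigD1 g) //= ffunE eqxx big1 ?addr0 // => y /andP[_ /negPf y_neq].
  by rewrite ffunE y_neq.
rewrite big1 // => y /eqP phi_y; rewrite ffunE; case: eqP => // y_g.
by case: phi_neq; rewrite -y_g.
Qed.

Fact galg_map_is_monoid_morphism : monoid_morphism galg_map.
Proof.
have phi1 : phi 1%g = 1%g by apply: (mulgI (phi 1%g)); rewrite -gmulfM !mulg1.
split=> [|a b]; first by rewrite galg_map_basis phi1.
apply/ffunP => x; rewrite !ffunE.
transitivity (\sum_y a y * \sum_(z | phi z == ((phi y)^-1 * x)%g) b z).
  transitivity (\sum_(z | phi z == x) \sum_y a y * b (y^-1 * z)%g).
    by apply: eq_bigr => z _; rewrite ffunE.
  rewrite exchange_big; apply: eq_bigr => y _; rewrite mulr_sumr.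
  (* Translation by [y] carries the fibre of [phi] over [(phi y)^-1 * x] onto the fibre over [x]. *)
  rewrite (reindex_inj (mulgI y)) /=; apply: eq_big => z; last by rewrite mulKg.
  by rewrite gmulfM -(inj_eq (mulgI (phi y)^-1%g)) mulKg.
rewrite (partition_big phi predT) //=; apply: eq_bigr => w _.
rewrite ffunE mulr_suml; apply: eq_bigr => y /eqP <-.
by rewrite ffunE.
Qed.
HB.instance Definition _ :=
  GRing.isMonoidMorphism.Build galg galg galg_map galg_map_is_monoid_morphism.
End Functoriality.

(* A unit [a] has odd support, and the sum of all the elements of [gT] is not a
   unit since it is fixed by translations. *)
Lemma galg_unit_small a b : (1 < #|gT| <= 3)%N -> a * b = 1 ->
  exists g, gbasis g = a.
Proof.
move=> /andP[gT_gt1 gT_le3] ab1.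
pose aug c := \sum_x c x.
have augM c d : aug (c * d) = aug c * aug d.
  transitivity (\sum_x \sum_y c y * d (y^-1 * x)%g).
    by apply: eq_bigr => x _; rewrite ffunE.
  rewrite exchange_big mulr_suml; apply: eq_bigr => y _.
  by rewrite -mulr_sumr /aug [in RHS](reindex_inj (mulgI y^-1%g)).
have aug1 : aug 1 = 1.
  rewrite /aug (bigD1 1%g) //= ffunE eqxx big1 ?addr0 // => x /negPf x_neq.
  by rewrite ffunE x_neq.
pose X := [set x | a x != 0].
have aX x : a x = (x \in X)%:R.
  by rewrite inE; case: (a x) => [[|[|]]] // lt; apply/val_inj.
have X_odd : odd #|X|.
  have aug_a : aug a = #|X|%:R.
    rewrite /aug -sum1_card natr_sum [RHS]big_mkcond; apply: eq_bigr => x _.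
    by rewrite aX; case: (x \in X).
  apply/negPn/negP => X_even; have /eqP := augM a b.
  rewrite ab1 aug1 aug_a -[#|X|]odd_double_half (negPf X_even) -muln2 natrM.
  by rewrite [2%:R](_ : _ = 0) ?mulr0 ?mul0r ?oner_eq0 //; apply/val_inj.
have [X1|X_neq1] := eqVneq #|X| 1%N.
  have /eqP/cards1P[g Xg] := X1; exists g; apply/ffunP => x.
  by rewrite aX Xg ffunE inE.
have X3 : #|X| = #|gT|.
  apply/eqP; rewrite eqn_leq max_card (leq_trans gT_le3) //.
  by move: X_odd X_neq1; case: #|X| => [|[|[|]]].
have XT x : x \in X.
  have /eqP -> : X == setT by rewrite eqEcard subsetT cardsT X3 leqnn.
  by rewrite inE.
have [g g_neq1] : exists g : gT, g != 1%g.
  apply/existsP; apply: contraLR gT_gt1 => /existsPn gT1.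
  rewrite -leqNgt -cardsT -(cards1 (1 : gT)%g) subset_leq_card //.
  by apply/subsetP => x _; rewrite inE; apply/negPn/gT1.
case/eqP: g_neq1; apply: gbasis_inj.
have ga : gbasis g * a = a.
  by rewrite [LHS]gconv_basisl; apply/ffunP => x; rewrite ffunE !aX !XT.
by rewrite -[LHS]mulr1 -ab1 mulrA ga.
Qed.

Lemma fully_realizable_small : (1 < #|gT| <= 3)%N -> fully_realizable gT.
Proof.
move=> gT_small; exists galg, gunit; split=> [|phi]; last first.
  by exists (galg_map phi) => g; apply/uval_inj/esym/galg_map_basis.
have unitP (v : units galg) : exists g, gbasis g == uval v.
  have [g gv] := galg_unit_small gT_small (uval_mulV v).
  by exists g; apply/eqP.
exists (fun v => xchoose (unitP v)) => [g|v].
  by apply: gbasis_inj; apply/eqP/(xchooseP (unitP (gunit g))).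
by apply/uval_inj/eqP/(xchooseP (unitP v)).
Qed.
End GroupAlgebra.

Theorem theorem6p2 (gT : finGroupType) (gT_simple : simple [set: gT]) :
  fully_realizable gT <->
  ([set: gT] \isog [set: 'Z_2] \/ [set: gT] \isog [set: 'Z_3]).
Proof.
split=> [realG|isoG]; last first.
  apply: fully_realizable_small; rewrite -cardsT.
  by case: isoG => /card_isog->; rewrite cardsT card_ord.
have cGG := fully_realizable_simple_abelian gT_simple realG.
have p_pr : prime #|gT| by rewrite -cardsT simple_sol_prime ?abelian_sol.
have cycG : cyclic [set: gT] by rewrite prime_cyclic ?cardsT.
have isoZ n : #|gT| = n.+2 -> [set: gT] \isog [set: 'Z_n.+2].
  move=> gTn; rewrite isog_cyclic_card // !cardsT gTn card_ord eqxx andbT.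
  by apply/cyclicP; exists (Zp1 : 'Z_n.+2); apply: Zp_cycle.
have [p2|p_neq2] := eqVneq #|gT| 2; first by left; apply: isoZ.
have [p3|p_neq3] := eqVneq #|gT| 3; first by right; apply: isoZ.
(* A prime other than 2 and 3 is coprime to 6; the group would then be trivial, against its prime
   order. *)
have n6 : coprime #|gT| 6.
  rewrite (@coprimeMr _ 2 3) !prime_coprime // !dvdn_prime2 //.
  by rewrite p_neq2 p_neq3.
have := prime_gt1 p_pr; rewrite -cardsT.
suff -> : [set: gT] = 1%g by rewrite cards1.
apply/setP => g; rewrite !inE.
by rewrite (fully_realizable_abelian_coprime6 cGG n6 realG g) eqxx.
Qed.
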